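(* Let $A$ be an abelian group of non-prime-power order, and write $$A\cong \mathbb{Z}_{d_1}\times \mathbb{Z}_{d_2}\times\cdots\times\mathbb{Z}_{d_k},$$ where $d_i\mid d_{i+1}$ for $1\le i\le k-1$ (so $d_k$ is not a power of a prime). Then $$\mathrm{sdim}(\Gamma_A)=\prod_{i=1}^k d_i-(\sigma_{d_k}+1).$$
   Context: All groups are finite. The power graph $\Gamma_G$ of a finite group $G$ has vertex set $G$, and two distinct elements are adjacent if one is a power of the other. For vertices $x,y,z$ of a graph $\Gamma$ with vertex set $V(\Gamma)$, the vertex $z$ strongly resolves $x$ and $y$ if there exists a shortest path from $z$ to $x$ containing $y$, or a shortest path from $z$ to $y$ containing $x$. A subset $S$ of $V(\Gamma)$ is a strong resolving set of $\Gamma$ if every pair of vertices of $\Gamma$ is strongly resolved by some vertex of $S$. The strong metric dimension $\mathrm{sdim}(\Gamma)$ is the smallest cardinality of a strong resolving set of $\Gamma$. $\mathbb{Z}_d$ denotes the cyclic group of order $d$. For a positive integer $n=p_1^{r_1}p_2^{r_2}\cdots p_m^{r_m}$, where $p_1,\dots,p_m$ are distinct primes and $r_i\ge 1$ for $1\le i\le m$, set $\sigma_n=1$ if $m=1$ and $\sigma_n=\sum_{i=1}^m r_i$ if $m\ge 2$.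
   Formalization: The group A is additionally assumed to be non-cyclic: for every cyclic A of non-prime-power order the stated formula fails (for example, for Z_6 the strong metric dimension is 4, while the formula gives 3). *)

(* Defs.v *)
From mathcomp Require Import all_boot all_fingroup all_algebra all_solvable.
From mathcomp Require Import boolp.

Set Implicit Arguments.
Unset Strict Implicit.
Unset Printing Implicit Defensive.

Import GroupScope.

(* The vertex set is the whole type [gT]; [x \in <[y]>] says that x is a power
   of y (cf. [cycleP]). *)
Definition power_graph (gT : finGroupType) : rel gT :=
  fun x y => (x != y) && ((x \in <[y]>) || (y \in <[x]>)).

Section StrongMetricDimension.

Variables (T : finType) (e : rel T).
Implicit Types (x y z : T) (p q : seq T) (S : {set T}).

(* The sequence z :: p lists the vertices of the walk; a walk of minimal length
   has no repeated vertex, so shortest walks are shortest paths. *)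
Definition walk z x p := path e z p && (last z p == x).

Definition shortest_path z x p : Prop :=
  walk z x p /\ forall q, walk z x q -> (size p <= size q)%N.

Definition strongly_resolves z x y : Prop :=
  (exists2 p, shortest_path z x p & y \in z :: p)
  \/ (exists2 p, shortest_path z y p & x \in z :: p).

Definition strong_resolving_set S : Prop :=
  forall x y, x != y -> exists2 z, z \in S & strongly_resolves z x y.

(* The search starts at [set: T], which is strongly resolving as soon as some
   set is (see [sdimP]), in particular whenever the graph is connected; in a
   graph without strong resolving sets the value is the junk value #|T|. *)
Definition sdim : nat :=
  #|[arg min_(S < [set: T] | `[< strong_resolving_set S >]) #|S| ]|.

Lemma sdimP S0 : strong_resolving_set S0 ->
  (exists2 S, strong_resolving_set S & #|S| = sdim)
  /\ (forall S, strong_resolving_set S -> (sdim <= #|S|)%N).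
Proof.
move=> resS0; rewrite /sdim; case: arg_minnP => [|S /asboolP resS minS].
  by apply/asboolP => x y /resS0[z _ zxy]; exists z; rewrite ?inE.
by split=> [|S' /asboolP/minS]; first by exists S.
Qed.

End StrongMetricDimension.

Definition sigma (n : nat) : nat :=
  if size (primes n) == 1%N then 1%N else (\sum_(p <- primes n) logn p n)%N.

(* Main.v *)
Require Import Defs.
From mathcomp Require Import all_boot all_fingroup all_algebra all_solvable.

Import GroupScope GRing.Theory.

(** The identity is adjacent to every other vertex of the power graph, so all
    distances are at most 2.  In such a graph a vertex z outside {x, y} strongly
    resolves x and y exactly when x and y are adjacent and z lies in just one of
    their closed neighbourhoods.  Hence S is strongly resolving if and only if
    its complement is a clique without twins (vertices sharing a closed
    neighbourhood): a witness z for two vertices of a clique C is nonadjacent to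
    one of them, so z cannot belong to C ([strong_resolving_setP]).  The strong
    metric dimension is therefore the number of vertices minus the largest size
    of a twin-free clique ([sdim_universal]).

    A clique of the power graph is a set of elements whose cyclic subgroups form
    a chain, and two elements generating the same subgroup are twins; so the
    orders of the members of a twin-free clique form a strict divisor chain, and
    there are at most Omega(e) + 1 of them, where e is the exponent and Omega
    counts prime factors with multiplicity ([twin_free_clique_card_le]).

    The bound is reached inside <[g]> for g of order e.  Comparable elements x in
    <[y]> of different orders can be twins only if x = 1 and y is adjacent to
    everything, or x != 1 and x is comparable with all of <[y]>.  An element
    x != 1 comparable with all elements of a group H that contains it and is not
    a p-group must generate H ([sub_cycle_of_comparable]); as the whole group is
    not cyclic this excludes the first case, and it excludes the second one as
    soon as y does not have prime power order.  So it suffices to choose a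
    maximal chain 1, p, p * q, ..., e of divisors with p and q distinct primes:
    p is then its only nontrivial prime power ([exists_twin_free_clique]).

    For a product of cyclic groups along a divisor chain the exponent is the last
    factor d; it is not a prime power, so sigma d is Omega(d). *)

(** * Strong resolving sets in a graph with a universal vertex *)

Definition closed_nbhd {T : finType} (e : rel T) (x : T) : {set T} :=
  [set z | (z == x) || e x z].

Definition twin_free_clique {T : finType} (e : rel T) (C : {set T}) : Prop :=
  {in C &, forall x y, x != y -> e x y /\ closed_nbhd e x <> closed_nbhd e y}.

(** The direct edge, or else the detour through the universal vertex. *)
Lemma exists_shortest_path {T : finType} (e : rel T) (u x y : T) :
    symmetric e -> (forall z, z != u -> e u z) ->
  exists2 p, shortest_path e x y p & (size p <= 2)%N.
Proof.
move=> symE univ.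
have [<-|nxy] := eqVneq x y.
  by exists [::]; split; rewrite // /walk /= eqxx.
have [exy|nexy] := boolP (e x y).
  exists [:: y] => //; split; first by rewrite /walk /= exy eqxx.
  by case=> [|? ?] //; rewrite /walk /= (negPf nxy).
have nxu : x != u.
  by apply: contraNneq nexy => xu; rewrite xu univ // -xu eq_sym.
have nyu : y != u by apply: contraNneq nexy => ->; rewrite symE univ.
exists [:: u; y] => //; split; first by rewrite /walk /= symE !univ // eqxx.
case=> [|a [|b q]] //; rewrite /walk /=; first by rewrite (negPf nxy).
by rewrite andbT => /andP[+ /eqP yE]; rewrite yE (negPf nexy).
Qed.

Lemma strongly_resolves_endpoint {T : finType} (e : rel T) (u x y : T) :
    symmetric e -> (forall z, z != u -> e u z) ->
  strongly_resolves e x x y /\ strongly_resolves e y x y.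
Proof.
move=> symE univ; split.
  have [p pP _] := exists_shortest_path e u x y symE univ.
  by right; exists p; rewrite ?mem_head.
have [p pP _] := exists_shortest_path e u y x symE univ.
by left; exists p; rewrite ?mem_head.
Qed.

(** Since shortest paths have length at most 2, an inner vertex y of one of
    them from z to x can only be its midpoint. *)
Lemma shortest_path_through {T : finType} (e : rel T) (u z x y : T) :
    symmetric e -> (forall z, z != u -> e u z) ->
    x != y -> z != x -> z != y ->
  (exists2 p, shortest_path e z x p & y \in z :: p) <->
  [/\ e z y, e y x & ~~ e z x].
Proof.
move=> symE univ nxy nzx nzy; split=> [[p [walkp minp] yp]|[ezy eyx nezx]].
  have [q [walkq _] szq] := exists_shortest_path e u z x symE univ.
  have szp := leq_trans (minp q walkq) szq.
  have nez : (1 < size p)%N -> ~~ e z x.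
    rewrite ltnNge; apply: contra => ezx.
    by apply: (minp [:: x]); rewrite /walk /= ezx eqxx.
  move: yp walkp szp nez; rewrite {minp} inE eq_sym (negPf nzy) /=.
  rewrite /walk; case: p => [|a [|b [|c p]]] //=; rewrite !inE.
    move=> /eqP ya /andP[_ /eqP ax].
    by rewrite -ax -ya eqxx in nxy.
  move=> yab /andP[/and3P[eza eab _] /eqP bx] _ -> //.
  have ya : y = a.
    by case/orP: yab => /eqP // yb; rewrite yb bx eqxx in nxy.
  by rewrite ya -bx.
exists [:: y; x]; last by rewrite !inE eqxx orbT.
split; first by rewrite /walk /= ezy eyx eqxx.
case=> [|a [|b q]] //; rewrite /walk /=; first by rewrite (negPf nzx).
by rewrite andbT => /andP[+ /eqP aE]; rewrite aE (negPf nezx).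
Qed.

Lemma strongly_resolves_nbhd {T : finType} (e : rel T) (u z x y : T) :
    symmetric e -> (forall z, z != u -> e u z) ->
    x != y -> z != x -> z != y ->
  strongly_resolves e z x y <->
  e x y /\ (z \in closed_nbhd e x) != (z \in closed_nbhd e y).
Proof.
move=> symE univ nxy nzx nzy.
have nyx : y != x by rewrite eq_sym.
rewrite /strongly_resolves (shortest_path_through e u) //.
rewrite (shortest_path_through e u z y x) // !inE (negPf nzx) (negPf nzy) /=.
rewrite !(symE z) (symE y x).
case: (e x z); case: (e y z); case: (e x y); split=> [[[]|[]]|[]] //= _ _.
  by right.
by left.
Qed.

(** Two vertices one of which lies in S are resolved by that vertex itself, so
    only pairs in the complement matter.  For them a vertex in exactly one of the
    two closed neighbourhoods is automatically in S, because the complement is a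
    clique: being twin-free is all that remains of the condition. *)
Lemma strong_resolving_setP {T : finType} (e : rel T) (u : T) (S : {set T}) :
    symmetric e -> (forall z, z != u -> e u z) ->
  strong_resolving_set e S <-> twin_free_clique e (~: S).
Proof.
move=> symE univ; split=> [resS x y|tfS x y nxy].
  rewrite !inE => Sx Sy nxy; have [z Sz rz] := resS x y nxy.
  have nzx : z != x by apply: contraNneq Sx => <-.
  have nzy : z != y by apply: contraNneq Sy => <-.
  move/(strongly_resolves_nbhd e u z x y symE univ nxy nzx nzy): rz.
  by case=> exy neqz; split=> // eqN; rewrite eqN eqxx in neqz.
have [rx ry] := strongly_resolves_endpoint e u x y symE univ.
have [Sx|Sx] := boolP (x \in S); first by exists x.
have [Sy|Sy] := boolP (y \in S); first by exists y.
have [||exy neqN] := tfS x y _ _ nxy; rewrite ?inE //.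
have [z neqz | eqz] := pickP
  (fun z => (z \in closed_nbhd e x) != (z \in closed_nbhd e y)); last first.
  case: neqN; apply/setP => z; apply/eqP.
  by rewrite -[_ == _]negbK eqz.
have nzx : z != x.
  by apply: contraNneq neqz => ->; rewrite !inE eqxx symE exy orbT.
have nzy : z != y.
  by apply: contraNneq neqz => ->; rewrite !inE eqxx exy orbT.
exists z; last by apply/(strongly_resolves_nbhd e u).
apply: contraNT neqz => Sz.
have [|||exz _] := tfS x z; rewrite ?inE // 1?eq_sym //.
have [|||eyz _] := tfS y z; rewrite ?inE // 1?eq_sym //.
by rewrite exz eyz !orbT.
Qed.

Lemma sdim_universal {T : finType} (e : rel T) (u : T) (C : {set T}) :
    symmetric e -> (forall z, z != u -> e u z) ->
    twin_free_clique e C ->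
    (forall C', twin_free_clique e C' -> #|C'| <= #|C|)%N ->
  (sdim e + #|C|)%N = #|T|.
Proof.
move=> symE univ tfC maxC.
have resC : strong_resolving_set e (~: C).
  by apply/(strong_resolving_setP e u); rewrite ?setCK.
have [[S resS cardS] /(_ _ resC) minC] := sdimP resC.
have /maxC leC : twin_free_clique e (~: S) by apply/(strong_resolving_setP e u).
apply/eqP; rewrite eqn_leq; apply/andP; split.
  by rewrite -(cardsC C) addnC leq_add2l.
by rewrite -(cardsC S) cardS leq_add2l.
Qed.

(** * The number of prime factors *)

Definition bigomega (n : nat) : nat := (\sum_(p <- primes n) logn p n)%N.

(** A summation range common to all the arguments involved turns
    multiplicativity of [logn] into additivity of [bigomega]. *)
Lemma bigomega_wide (b n : nat) : (0 < n)%N -> (n < b)%N ->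
  bigomega n = (\sum_(0 <= p < b) logn p n)%N.
Proof.
move=> n0 ltnb; rewrite /bigomega [RHS](bigID (mem (primes n))) /=.
rewrite [X in _ = (_ + X)%N]big1 ?addn0; last first.
  by move=> p; rewrite -logn_gt0 lt0n negbK => /eqP.
rewrite -[RHS]big_filter; apply: perm_big; apply: uniq_perm.
- exact: primes_uniq.
- by rewrite filter_uniq // iota_uniq.
move=> p; rewrite mem_filter mem_index_iota /=.
case pn: (p \in primes n) => //=; apply/esym.
move: pn; rewrite mem_primes => /and3P[_ _ /(dvdn_leq n0) le_pn].
exact: leq_ltn_trans le_pn ltnb.
Qed.

Lemma bigomegaM (m n : nat) : (0 < m)%N -> (0 < n)%N ->
  bigomega (m * n) = (bigomega m + bigomega n)%N.
Proof.
move=> m0 n0; pose b := (m * n).+1.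
rewrite !(@bigomega_wide b) ?muln_gt0 ?m0 ?n0 //; first last.
- by rewrite ltnS leq_pmulr.
- by rewrite ltnS leq_pmull.
by rewrite -big_split; apply: eq_bigr => p _; rewrite lognM.
Qed.

Lemma bigomega_prime (p : nat) : prime p -> bigomega p = 1%N.
Proof.
by move=> pp; rewrite /bigomega primes_prime // big_seq1 logn_prime // eqxx.
Qed.

Lemma bigomega_gt0 (n : nat) : (1 < n)%N -> (0 < bigomega n)%N.
Proof.
move=> n1; rewrite -(divnK (pdiv_dvd n)) mulnC bigomegaM ?pdiv_gt0 //.
  by rewrite bigomega_prime ?pdiv_prime.
by rewrite divn_gt0 ?pdiv_gt0 // dvdn_leq ?pdiv_dvd // ltnW.
Qed.

Lemma bigomega_dvd (m n : nat) : (0 < n)%N -> (m %| n)%N ->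
  (bigomega m <= bigomega n ?= iff (m == n))%N.
Proof.
move=> n0 /dvdnP[k def_n]; subst n; move: n0; rewrite muln_gt0 => /andP[k0 m0].
rewrite bigomegaM //; split; first exact: leq_addl.
rewrite -{1}[bigomega m]add0n eqn_add2r -{1}[m]mul1n eqn_pmul2r //.
have [k1|k1] := eqVneq 1%N k; first by rewrite -k1 /bigomega big_nil.
have : (0 < bigomega k)%N by apply: bigomega_gt0; rewrite ltn_neqAle k1.
by rewrite eq_sym lt0n => /negPf.
Qed.

(** A maximal chain of divisors from a to n: each step multiplies by one prime,
    so it takes as many steps as n / a has prime factors.  Divisibility by c is
    inherited from a; recording it in the path relation lets the chain be glued
    to a relation that demands it. *)
Lemma divisor_chain (c a n : nat) :
    (0 < n)%N -> (c %| a)%N -> (a %| n)%N ->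
  exists s, [/\ path (fun m m' => [&& m < m', m %| m' & c %| m'])%N a s,
    all (fun m => m %| n)%N s & size s = bigomega (n %/ a)].
Proof.
move=> n0; have [h] := ubnP (n %/ a); elim: h a => // h IH a ltah ca an.
have a0 : (0 < a)%N := dvdn_gt0 n0 an.
have na0 : (0 < n %/ a)%N by rewrite divn_gt0 // dvdn_leq.
have [na1|na1] := eqVneq (n %/ a)%N 1%N.
  by exists [::]; rewrite na1 /bigomega big_nil.
have na_gt1 : (1 < n %/ a)%N by rewrite ltn_neqAle eq_sym na1.
pose p := pdiv (n %/ a).
have pp : prime p by rewrite pdiv_prime.
have apn : (a * p %| n)%N by rewrite -(divnK an) mulnC dvdn_pmul2r ?pdiv_dvd.
have nE : (n %/ a = p * (n %/ (a * p)))%N.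
  by rewrite divnMA mulnC divnK ?pdiv_dvd.
have q0 : (0 < n %/ (a * p))%N by move: na0; rewrite nE muln_gt0 => /andP[].
have [|||s [path_s all_s sz_s]] := IH (a * p)%N.
- rewrite -ltnS; apply: leq_trans ltah.
  by rewrite ltnS nE ltn_Pmull ?prime_gt1.
- exact: dvdn_mulr.
- exact: apn.
exists (a * p :: s)%N; split=> /=.
- by rewrite path_s dvdn_mulr // dvdn_mulr // ltn_Pmulr ?prime_gt1.
- by rewrite apn.
by rewrite sz_s nE (bigomegaM p) ?(prime_gt0 pp) // (bigomega_prime p pp) add1n.
Qed.

Lemma prime_divisor_neq (p n : nat) : (0 < n)%N -> ~~ p.-nat n ->
  exists q, [/\ prime q, (q %| n)%N & q != p].
Proof.
rewrite /pnat => -> /allPn[q]; rewrite mem_primes => /and3P[qp _ qn] npq.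
by exists q.
Qed.

(** * Comparable cyclic subgroups *)

Lemma power_graph_sym (gT : finGroupType) : symmetric (@power_graph gT).
Proof. by move=> x y; rewrite /power_graph eq_sym orbC. Qed.

Lemma power_graph_universal (gT : finGroupType) (z : gT) :
  z != 1 -> power_graph (1 : gT) z.
Proof. by rewrite /power_graph eq_sym group1 => ->. Qed.

Lemma mem_power_nbhd {gT : finGroupType} (x z : gT) :
  (z \in closed_nbhd (@power_graph gT) x) = (z \in <[x]>) || (x \in <[z]>).
Proof.
rewrite inE /power_graph; have [->|] := eqVneq z x; first by rewrite cycle_id.
by rewrite /= orbC.
Qed.

(** If x were a p-element, an element of H of another prime order q would be
    incomparable with x.  So x is not a p-element for any p, hence is not a power
    of any p-element; comparability then puts every p-element of H in <[x]>, and
    H is generated by those. *)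
Lemma sub_cycle_of_comparable {gT : finGroupType} (H : {group gT}) (x : gT) :
    x \in H -> x != 1 -> (forall p : nat, ~~ p.-group H) ->
    {in H, forall z, (z \in <[x]>) || (x \in <[z]>)} ->
  H \subset <[x]>.
Proof.
move=> Hx x1 npH cmp.
have npx (p : nat) : ~~ p.-elt x.
  apply/negP => px.
  have [q [qp qH npq]] := prime_divisor_neq p _ (cardG_gt0 H) (npH p).
  have [z Hz oz] := Cauchy qp qH.
  have npz : ~~ p.-elt z by rewrite /p_elt oz pnatE.
  case/orP: (cmp z Hz) => [zx|xz].
    by case/negP: npz; apply: mem_p_elt zx.
  have qx : q.-elt x by apply: mem_p_elt xz; rewrite /pgroup -orderE oz pnat_id.
  have : coprime #[x] #[x].
    apply: (@pnat_coprime p) => //; apply: pi_pnat qx _.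
    by rewrite !inE.
  by rewrite /coprime gcdnn order_eq1 (negPf x1).
apply/subsetP => z Hz; rewrite -[z]prod_constt group_prod // => p _.
case/orP: (cmp _ (groupX _ Hz : z.`_p \in H)) => // xz.
by case/negP: (npx p); apply: mem_p_elt xz; apply: p_elt_constt.
Qed.

Lemma same_order_same_nbhd {gT : finGroupType} (x y : gT) :
    power_graph x y -> #[x] = #[y] ->
  closed_nbhd (@power_graph gT) x = closed_nbhd (@power_graph gT) y.
Proof.
move=> /andP[_ xy] oxy.
have exy : <[x]> = <[y]>.
  apply/eqP; case/orP: xy; rewrite -cycle_subG => s.
    by rewrite eqEcard s -!orderE oxy leqnn.
  by rewrite eq_sym eqEcard s -!orderE oxy leqnn.
apply/setP => z; rewrite !mem_power_nbhd exy.
by rewrite -[x \in _]cycle_subG -[y \in _]cycle_subG exy.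
Qed.

(** If the neighbourhoods agree, then [sub_cycle_of_comparable] applies to the
    larger element y in the whole group when x = 1 (y is then universal), and to
    x in <[y]> otherwise. *)
Lemma nbhd_neq {gT : finGroupType} (x y : gT) :
    ~~ cyclic [set: gT] -> (forall p : nat, ~~ p.-group [set: gT]) ->
    x \in <[y]> -> (#[x] < #[y])%N ->
    x == 1 \/ (forall p : nat, ~~ p.-elt y) ->
  closed_nbhd (@power_graph gT) x <> closed_nbhd (@power_graph gT) y.
Proof.
move=> ncG npG xy ltxy cases eqN.
have cmp z : z \in <[y]> -> (z \in <[x]>) || (x \in <[z]>).
  by move=> zy; rewrite -mem_power_nbhd eqN mem_power_nbhd zy.
have [x1|nx1] := eqVneq x 1.
  have y1 : y != 1 by rewrite -order_gt1; move: ltxy; rewrite x1 order1.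
  case/negP: ncG; apply/cyclicP; exists y; apply/eqP.
  rewrite eq_sym eqEsubset subsetT /=.
  apply: sub_cycle_of_comparable => // [|z _]; first exact: in_setT.
  by rewrite -mem_power_nbhd -eqN mem_power_nbhd x1 group1 orbT.
have npy : forall p : nat, ~~ p.-elt y.
  by case: cases => // /eqP x1; rewrite x1 eqxx in nx1.
have /subset_leq_card := sub_cycle_of_comparable <[y]> x xy nx1 npy cmp.
by rewrite -!orderE leqNgt ltxy.
Qed.

(** * Twin-free cliques of the power graph *)

(** On a twin-free clique the number of prime factors of the order is an
    injective invariant: of two adjacent elements one has order dividing the
    other, a proper divisor has fewer prime factors, and equal orders would make
    them twins. *)
Lemma twin_free_clique_card_le {gT : finGroupType} (C : {set gT}) :
    twin_free_clique (@power_graph gT) C ->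
  (#|C| <= (bigomega (exponent [set: gT])).+1)%N.
Proof.
move=> tfC; set n := exponent _.
have n0 : (0 < n)%N by apply: exponent_gt0.
have oP (x : gT) : (#[x] %| n)%N by apply: dvdn_exponent; rewrite inE.
pose f (x : gT) : 'I_(bigomega n).+1 := inord (bigomega #[x]).
have fE x : f x = bigomega #[x] :> nat.
  by rewrite inordK // ltnS; apply: (bigomega_dvd _ _ n0 (oP x)).
rewrite -[X in (_ <= X)%N]card_ord -(@card_in_imset _ _ f) ?max_card //.
move=> x y Cx Cy /(congr1 val) /=; rewrite !fE => eqf.
apply/eqP; apply/negPn/negP => nxy; have [exy neqN] := tfC x y Cx Cy nxy.
apply: neqN; apply: (same_order_same_nbhd x y exy).
case/andP: exy => _ /orP[] /order_dvdG; rewrite -orderE => dv.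
  by apply/eqP; rewrite -(bigomega_dvd _ _ (order_gt0 y) dv) eqf.
by apply/esym/eqP; rewrite -(bigomega_dvd _ _ (order_gt0 x) dv) eqf.
Qed.

(** The powers of g whose orders run through a divisor chain 1, p, p * q, ..., n
    with p != q prime.  In every pair m, m' of the chain with m < m', either
    m = 1 or p * q divides m', which is what [nbhd_neq] requires. *)
Lemma exists_twin_free_clique {gT : finGroupType} (g : gT) :
    ~~ cyclic [set: gT] -> (forall p : nat, ~~ p.-group [set: gT]) ->
    (forall p : nat, ~~ p.-elt g) ->
  exists2 C : {set gT}, twin_free_clique (@power_graph gT) C
    & #|C| = (bigomega #[g]).+1.
Proof.
move=> ncG npG npg; set n := #[g].
have n0 : (0 < n)%N := order_gt0 g.
have n1 : (1 < n)%N.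
  rewrite order_gt1; apply: contraNneq (npg 2) => ->.
  by rewrite /p_elt order1.
pose p := pdiv n.
have pp : prime p by rewrite pdiv_prime.
have [q [qp qn npq]] := prime_divisor_neq p n n0 (npg p).
have pqn : (p * q %| n)%N.
  by rewrite Gauss_dvd ?pdiv_dvd // prime_coprime // dvdn_prime2 // eq_sym.
have [s [path_s all_s size_s]] := divisor_chain (p * q) (p * q) n n0 (dvdnn _) pqn.
pose R m m' := [&& m < m', m %| m' & (m == 1) || (p * q %| m')]%N.
have R_trans : transitive R.
  move=> b a c /and3P[ab dab h1] /and3P[bc dbc h2].
  rewrite /R (ltn_trans ab bc) (dvdn_trans dab dbc) /=.
  case/orP: h1 => [->//|h1]; by rewrite (dvdn_trans h1 dbc) orbT.
pose D := [:: 1, p, p * q & s]%N.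
have sortedD : sorted R D.
  rewrite /= /R prime_gt1 ?dvd1n //=.
  rewrite ltn_Pmulr ?prime_gt1 ?prime_gt0 // dvdn_mulr // dvdnn orbT /=.
  apply: sub_path path_s => m m' /= /and3P[-> -> ->]; exact: orbT.
have uniqD : uniq D.
  by apply: (@sorted_uniq _ R) => // m; rewrite /R ltnn.
have divD : {in D, forall m, m %| n}%N.
  apply/allP; rewrite /= dvd1n pdiv_dvd pqn all_s //.
pose h m := g ^+ (n %/ m).
have oh m : m \in D -> #[h m] = m.
  move=> /divD mn; rewrite /h orderXdiv -/n ?dvdn_div //.
  by rewrite divnA // mulKn.
have hh m m' : m \in D -> m' \in D -> (m %| m')%N -> h m \in <[h m']>.
  move=> Dm Dm' dv; rewrite -cycle_subG.
  rewrite -(@cardSg_cyclic _ <[g]>) ?cycle_cyclic ?cycle_subG ?mem_cycle //.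
  by rewrite -!orderE !oh.
have inj_h : {in D &, injective h}.
  by move=> m m' Dm Dm' eqh; rewrite -(oh m) // eqh oh.
exists [set x in [seq h m | m <- D]]; last first.
  rewrite cardsE (card_uniqP _) ?map_inj_in_uniq // size_map /= size_s.
  have pq0 : (0 < p * q)%N := dvdn_gt0 n0 pqn.
  have npq0 : (0 < n %/ (p * q))%N by rewrite divn_gt0 // dvdn_leq.
  rewrite -[in RHS](divnK pqn) bigomegaM // (bigomegaM p) ?prime_gt0 //.
  by rewrite (bigomega_prime p) // (bigomega_prime q) // addn2.
have key m m' : m \in D -> m' \in D -> R m m' ->
    power_graph (h m) (h m') /\
    closed_nbhd (@power_graph gT) (h m) <> closed_nbhd (@power_graph gT) (h m').
  move=> Dm Dm' /and3P[ltm dvm cond].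
  have hm := hh m m' Dm Dm' dvm.
  split.
    rewrite /power_graph hm andbT; apply: contraTneq ltm => /(congr1 order).
    by rewrite !oh // => ->; rewrite ltnn.
  apply: nbhd_neq => //; first by rewrite !oh.
  case/orP: cond => [/eqP m1|pqm']; [left | right].
    by rewrite -order_eq1 oh ?m1.
  move=> r; apply/negP; rewrite /p_elt oh // => rm'.
  have := pnat_dvd pqm' rm'; rewrite pnatM !pnatE // !inE.
  by case/andP=> /eqP pr /eqP qr; case/eqP: npq; rewrite qr -pr.
move=> x y; rewrite !in_set => /mapP[m Dm ->] /mapP[m' Dm' ->] nh.
have : R m m' || R m' m.
  have nmm : m != m' by apply: contraNneq nh => ->.
  have lt_R := sorted_ltn_index R_trans sortedD.
  case: (ltngtP (index m D) (index m' D)) => [lt|lt|eq_i].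
  - by rewrite lt_R.
  - by rewrite orbC lt_R.
  by rewrite -(nth_index 0%N Dm) eq_i nth_index ?eqxx in nmm.
case/orP=> Rmm; first exact: key.
have [e1 e2] := key m' m Dm' Dm Rmm.
by split; [rewrite power_graph_sym | move/esym].
Qed.

(** Nilpotency serves to provide an element whose order is the exponent. *)
Theorem sdim_power_graph {gT : finGroupType} :
    nilpotent [set: gT] -> ~~ cyclic [set: gT] ->
    (forall p : nat, ~~ p.-group [set: gT]) ->
  (sdim (@power_graph gT) + (bigomega (exponent [set: gT])).+1)%N = #|gT|.
Proof.
move=> nilG ncG npG.
have [g _ eg] := exponent_witness nilG.
have [|C tfC cardC] := exists_twin_free_clique g ncG npG.
  move=> p; apply: contra (npG p) => pg.
  apply/pnatP => // q qp qG.
  have : q \in \pi([set: gT]) by rewrite mem_primes qp cardG_gt0.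
  rewrite -pi_of_exponent eg => qg; exact: (pnatPpi pg).
rewrite eg -cardC; apply: (sdim_universal _ 1) => //.
- exact: power_graph_sym.
- exact: power_graph_universal.
by move=> C' /twin_free_clique_card_le; rewrite eg cardC.
Qed.

(** * Products of cyclic groups *)

Lemma exponent_setXn_Zp (k : nat) (d : 'I_k.+1 -> nat) :
    (forall i, 0 < d i)%N ->
    (forall i j : 'I_k.+1, j = i.+1 :> nat -> (d i %| d j)%N) ->
  exponent (setXn (fun i : 'I_k.+1 => Zp (d i))) = d ord_max.
Proof.
move=> d0 dd.
have dmax (i : 'I_k.+1) : (d i %| d ord_max)%N.
  have [m] := ubnP (k - i); elim: m i => // m IH i lem.
  have [ik|] := ltnP i k; last first.
    rewrite leq_eqVlt ltnNge -ltnS ltn_ord orbF => /eqP ki.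
    by have -> : i = ord_max by apply: val_inj; rewrite /= -ki.
  have lt_i1 : (i.+1 < k.+1)%N by [].
  apply: dvdn_trans (dd i (Ordinal lt_i1) erefl) _; apply: IH => /=.
  by rewrite -ltnS -subSn.
have expX (f : {dffun forall i : 'I_k.+1, 'Z_(d i)}) m i :
  (f ^+ m) i = f i ^+ m.
  by elim: m => [|m IH]; rewrite ?expg0 ?ffunE // !expgS ffunE IH.
apply/eqP; rewrite eqn_dvd; apply/andP; split.
  apply/exponentP => f /setXnP fP; apply/ffunP => i; rewrite expX ffunE.
  apply/eqP; rewrite -order_dvdn; apply: dvdn_trans (dmax i).
  by have := order_dvdG (fP i); rewrite card_Zp.
have [d_le1|d_gt1] := leqP (d ord_max) 1.
  (* here 'Z_(d ord_max) has two elements, so its unit has the wrong order *)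
  have -> : d ord_max = 1%N by apply/eqP; rewrite eqn_leq d_le1 d0.
  exact: dvd1n.
pose f : {dffun forall i : 'I_k.+1, 'Z_(d i)} := dfung1 (Zp1 : 'Z_(d ord_max)).
have fP : f \in setXn (fun i : 'I_k.+1 => Zp (d i)).
  apply/setXnP => j; have [<-|nj] := eqVneq ord_max j.
    by rewrite /Zp d_gt1 in_setT.
  by rewrite dfung1_dflt // group1.
have /ffunP/(_ ord_max)/eqP := expg_exponent fP.
by rewrite expX dfung1_id ffunE -order_dvdn order_Zp1 Zp_cast.
Qed.

Theorem mainTheorem7 (gT : finGroupType) (k : nat) (d : 'I_k.+1 -> nat)
    (abelA : abelian [set: gT])
    (ncycA : ~~ cyclic [set: gT])
    (nppA : ~ exists p r : nat, prime p /\ #|[set: gT]| = (p ^ r)%N)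
    (d_gt0 : forall i, (0 < d i)%N)
    (d_dvd : forall i j : 'I_k.+1, j = i.+1 :> nat -> (d i %| d j)%N)
    (isoA : [set: gT] \isog setXn (fun i : 'I_k.+1 => Zp (d i))) :
  ((sdim (@power_graph gT))%:Z
   = (\prod_(i < k.+1) d i)%N%:Z - (sigma (d ord_max) + 1)%N%:Z)%R.
Proof.
have npA (p : nat) : ~~ p.-group [set: gT].
  apply/negP => pA; apply: nppA.
  have [A1|A1] := eqVneq [set: gT] 1.
    by exists 2, 0%N; rewrite A1 cards1.
  by have [pp _ [m ->]] := pgroup_pdiv pA A1; exists p, m.+1.
have expA : exponent [set: gT] = d ord_max.
  by rewrite (exponent_isog isoA) exponent_setXn_Zp.
have cardA : #|gT| = (\prod_(i < k.+1) d i)%N.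
  rewrite -cardsT (card_isog isoA) cardsXn; apply: eq_bigr => i _.
  exact: card_Zp.
have sigmaE : sigma (d ord_max) = bigomega (d ord_max).
  rewrite /sigma; case: ifP => // /eqP sz1.
  (* a single prime divisor p of the exponent would make the group a p-group *)
  have primesA : primes #|[set: gT]| = primes (d ord_max).
    by rewrite -expA primes_exponent.
  case def_p: (primes _) sz1 => [|p []] // _; case/negP: (npA p).
  by rewrite /pgroup /pnat cardG_gt0 primesA def_p /= inE eqxx.
rewrite sigmaE -cardA -(sdim_power_graph (abelian_nil abelA) ncycA npA) expA.
by rewrite addn1 PoszD addrK.
Qed.
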